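(* Suppose $0\le Z_t\le 1$ with probability 1 for all $t\in\{1,\ldots,T\}$. Then for all $k\ge 1$, $$0\le E_k-\mathrm{OPT}\le \frac1k .$$
   Context: Let $T,D\ge 1$ be integers. $\mathbf Y=(Y_1,\ldots,Y_T)$ is an arbitrary (possibly non-Markovian) discrete-time stochastic process, each $Y_t$ being a random vector in $\mathbb R^D$; $Y_{[t]}=(Y_1,\ldots,Y_t)$. $\mathcal F=(\mathcal F_t)_{t=1}^T$ is the natural filtration of $\mathbf Y$. For each $t$, $g_t:\mathbb R^{D\times t}\to\mathbb R$ is measurable and $Z_t=g_t(Y_{[t]})$ is the reward for stopping at $t$ (integrable and non-negative). $\mathcal T$ is the set of stopping times adapted to $\mathcal F$ with values in $\{1,\ldots,T\}$, and $\mathrm{OPT}=\sup_{\tau\in\mathcal T}E[Z_\tau]$, assumed strictly positive. Define $Z^1_t=Z_t$ and, for $k\ge1$ and $t\in\{1,\ldots,T\}$, $Z^{k+1}_t=Z^k_t-E\big[\max_{i=1,\ldots,T}Z^k_i\,\big|\,\mathcal F_t\big]$. Let $L_k=E[\max_{t=1,\ldots,T}Z^k_t]$ and $E_k=\sum_{i=1}^kL_i$. *)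

(* Defs.v *)
From HB Require Import structures.
From mathcomp Require Import all_boot all_order all_algebra.
From mathcomp Require Import all_classical all_reals all_analysis.
From mathcomp Require Import measurable_realfun.

Set Implicit Arguments.
Unset Strict Implicit.
Unset Printing Implicit Defensive.

Import Order.TTheory GRing.Theory Num.Theory.
Import numFieldNormedType.Exports.

Local Open Scope classical_set_scope.
Local Open Scope ring_scope.

Section conditional_expectation.
Context d (Omega : measurableType d) (R : realType) (P : probability Omega R).
Implicit Types (G : set_system Omega) (X W : Omega -> R).

(* [g_sigma_algebraType G] is [Omega] measured by [<<s G>>], which is [G]
   itself when [G] is a sigma-algebra. *)
Definition condexp_version G X W :=
  [/\ measurable_fun [set: g_sigma_algebraType G]
        (W : g_sigma_algebraType G -> R),
      P.-integrable [set: Omega] (EFin \o W) &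
      forall A, G A ->
        (\int[P]_(w in A) (W w)%:E = \int[P]_(w in A) (X w)%:E)%E].

(* E[X | G]: a chosen version; see [condexpP] for existence. *)
Definition condexp G X : Omega -> R := xget (cst 0) (condexp_version G X).

Lemma condexp_exists_along d' (S : measurableType d') (f : {mfun Omega >-> S})
    (X : Omega -> R) : P.-integrable setT (EFin \o X) ->
  exists h : S -> R, [/\ measurable_fun setT h,
    P.-integrable setT (EFin \o (h \o f)) &
    forall B, measurable B -> (\int[P]_(w in f @^-1` B) (h (f w))%:E =
                              \int[P]_(w in f @^-1` B) (X w)%:E)%E].
Proof.
move=> iX.
have mf : measurable_fun setT f by exact: measurable_funPT.
pose mu : probability S R := distribution P f.
pose nu0 : {charge set Omega -> \bar R} := induced_charge iX.
pose nuf : {charge set S -> \bar R} := pushforward nu0 f.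
pose nu : {charge set S -> \bar R} := nuf mf.
have dom : nu `<< mu.
  apply: (dominates_pushforward mf).
  apply/null_content_dominatesP => A mA PA.
  apply: null_set_integral => //.
  by apply: (measurable_funS measurableT) => //; exact: (measurable_int P).
have fin w : Radon_Nikodym nu mu w \is a fin_num.
  exact: Radon_Nikodym_fin_num.
have ih := Radon_Nikodym_integrable dom.
have mh : measurable_fun setT (Radon_Nikodym nu mu).
  exact: (measurable_int mu).
have ihP : P.-integrable setT (Radon_Nikodym nu mu \o f).
  apply/integrableP; split; first exact: measurableT_comp.
  move/integrableP : ih => [_]; rewrite ge0_integral_pushforward//.
  exact: measurableT_comp.
exists (fine \o Radon_Nikodym nu mu); split.
- exact: measurableT_comp.
- rewrite (_ : _ \o _ = Radon_Nikodym nu mu \o f)//.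
  by apply/funext => w /=; rewrite fineK// fin.
- move=> B mB; have := Radon_Nikodym_integral dom mB.
  rewrite (integral_pushforward mf mh)//; last first.
    apply: integrableS ihP => //.
    by rewrite -[X in measurable X]setTI; exact: (mf measurableT _ mB).
  rewrite /nu /nuf /nu0 /= /pushforward /induced_charge /= => ->.
  by apply: eq_integral => w _; rewrite fineK// fin.
Qed.

Lemma condexpP G X : sigma_algebra setT G -> G `<=` measurable ->
  P.-integrable setT (EFin \o X) -> condexp_version G X (condexp G X).
Proof.
move=> sG mG iX.
suff [W HW] : exists W, condexp_version G X W.
  by rewrite /condexp; case: xgetP => [y _ //|/(_ W)].
have GE : G.-sigma.-measurable = G by exact: measurable_g_measurableTypeE.
pose f : Omega -> g_sigma_algebraType G := id.
have mf : measurable_fun setT f.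
  by move=> _ A; rewrite GE => GA; rewrite setTI; exact: mG.
pose fM : {mfun Omega >-> g_sigma_algebraType G} :=
  HB.pack f (isMeasurableFun.Build _ _ _ _ f mf).
have [h [mh ih hX]] := condexp_exists_along fM iX.
by exists h; split => // A GA; apply: (hX A); rewrite GE.
Qed.

End conditional_expectation.

(* Times are the natural numbers [1 <= t <= T]; the values of the processes
   below at other indices are never used. *)
Section optimal_stopping.
Context d (Omega : measurableType d) (R : realType) (P : probability Omega R).
Variables (T D : nat) (Y : nat -> {RV P >-> D.-tuple R}).

Definition natural_filtration (t : nat) : set_system Omega :=
  g_sigma_preimage (fun i : 'I_t => Y i.+1 : Omega -> D.-tuple R).

Definition history (t : nat) (w : Omega) : t.-tuple (D.-tuple R) :=
  [tuple Y i.+1 w | i < t].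

Definition stopping_time (tau : Omega -> nat) :=
  (forall w, (1 <= tau w <= T)%N) /\
  forall t, (1 <= t <= T)%N ->
    natural_filtration t [set w | (tau w <= t)%N].

Variable g : forall t, t.-tuple (D.-tuple R) -> R.

Definition reward (t : nat) (w : Omega) : R := g (history t w).

Definition OPT : \bar R :=
  ereal_sup [set 'E_P[(fun w => reward (tau w) w)]%E | tau in stopping_time].

(* max_(t = 1, .., T) X_t for 1 <= T; seeding with [X 1] is harmless. *)
Definition path_max (X : nat -> Omega -> R) (w : Omega) : R :=
  \big[Num.max/X 1 w]_(1 <= i < T.+1) X i w.

(* [Zseq k] is Z^{k+1}. *)
Fixpoint Zseq (k : nat) : nat -> Omega -> R :=
  if k is k'.+1 then
    fun t w => Zseq k' t w
               - condexp P (natural_filtration t) (path_max (Zseq k')) w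
  else reward.

Definition Zk (k : nat) : nat -> Omega -> R := Zseq k.-1.

Definition Lk (k : nat) : \bar R := 'E_P[path_max (Zk k)]%E.

Definition Ek (k : nat) : \bar R := (\sum_(1 <= i < k.+1) Lk i)%E.

End optimal_stopping.

(* Main.v *)
Require Import Defs.
From HB Require Import structures.
From mathcomp Require Import all_boot all_order all_algebra.
From mathcomp Require Import all_classical all_reals all_analysis.
From mathcomp Require Import measurable_realfun.
From mathcomp Require Import lra.

Set Implicit Arguments.
Unset Strict Implicit.
Unset Printing Implicit Defensive.

Import Order.TTheory GRing.Theory Num.Theory.
Import numFieldNormedType.Exports.
Local Open Scope classical_set_scope.
Local Open Scope ring_scope.

(** Write [Z k] for [Zseq T Y g k], the process [Z^{k+1}], and [M k] for its
    path maximum, so that [Z k.+1 t = Z k t - E[M k | F_t]] and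
    [Ek k = E[M 0] + .. + E[M k.-1]].

    Stopping the recursion at a stopping time [tau] and taking expectations
    gives [E[Z k.+1 at tau] = E[Z k at tau] - E[M k]], because
    [t |-> E[M k | F_t]] is a martingale ([expectation_condexp_stopped]).
    Telescoping, the reward stopped at [tau] has expectation
    [Ek k + E[Z k at tau]] ([expectation_reward_stopped]), hence
    [Ek k - OPT] is the infimum over [tau] of [- E[Z k at tau]], and both
    inequalities are about that last expectation.

    It is nonpositive for [k >= 1] since [M k.-1] dominates the adapted
    process [Z k.-1], and so does its conditional expectation ([Zseq_le0]).
    Thus [OPT <= Ek k].

    For the rate, at the horizon [T] every [M j] is [F_T]-measurable, so the
    recursion becomes the pathwise identity [Z j.+1 T = Z j T - M j]
    ([Zseq_terminal]). Along almost every path one therefore has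
    [0 >= Z k.+1 T = Z 0 T - M 0 - (M 1 + .. + M k)] with [Z 0 T >= 0] and
    [M 0 <= 1], while [M 1 <= M 2 <= ..] since subtracting the conditional
    expectation of the nonpositive [M j] increases [Z j]. It follows that
    [- k * M k <= 1], i.e. [M k >= - 1 / k] almost surely
    ([path_max_Zseq_ge]). Stopping [Z k] when it first reaches the level
    [- 1 / k] then yields a stopping time with [E[Z k at tau] >= - 1 / k],
    and [OPT >= Ek k - 1 / k]. *)

(** * Integrals and almost everywhere inequalities *)

Section almost_everywhere_integrals.
Context d (Omega : measurableType d) (R : realType) (mu : measure Omega R).
Implicit Types U V : Omega -> R.

(** The pointwise comparison applies once [U] is replaced by [min U V], which
    agrees with it almost everywhere. *)
Lemma ae_le_integral (A : set Omega) U V : measurable A ->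
    mu.-integrable setT (EFin \o U) -> mu.-integrable setT (EFin \o V) ->
    {ae mu, forall w, U w <= V w} ->
  (\int[mu]_(w in A) (U w)%:E <= \int[mu]_(w in A) (V w)%:E)%E.
Proof.
move=> mA iU iV UV.
have iUA : mu.-integrable A (EFin \o U) by exact: integrableS iU.
have iVA : mu.-integrable A (EFin \o V) by exact: integrableS iV.
have mU := measurable_int _ iUA; have mV := measurable_int _ iVA.
have mM : measurable_fun A (EFin \o (fun w => Num.min (U w) (V w))).
  apply/measurable_EFinP; apply: measurable_minr; exact/measurable_EFinP.
have UM : ae_eq mu A (EFin \o U) (EFin \o (fun w => Num.min (U w) (V w))).
  by apply: filterS UV => w UVw _ /=; rewrite min_l.
rewrite [X in (X <= _)%E](ae_eq_integral _ _ mA mU mM UM).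
apply: le_integral => //; last by move=> w _; rewrite /= lee_fin ge_min lexx orbT.
apply/integrableP; split => //; case/integrableP : iUA => _; apply: le_lt_trans.
rewrite le_eqVlt; apply/orP; left; apply/eqP.
apply: ge0_ae_eq_integral => //; try exact: measurableT_comp.
by apply: filterS UM => w /[apply] ->.
Qed.

Lemma integrable_maxr (U V : Omega -> R) : mu.-integrable setT (EFin \o U) ->
    mu.-integrable setT (EFin \o V) ->
  mu.-integrable setT (EFin \o (U \max V)).
Proof.
move=> iU iV.
apply: (@le_integrable _ _ _ _ _ measurableT _
  (EFin \o (fun w => `|U w| + `|V w|))).
- apply/measurable_EFinP; apply: measurable_maxr; apply/measurable_EFinP.
    exact: measurable_int iU.
  exact: measurable_int iV.
- move=> w _; rewrite /= lee_fin.
  rewrite (@ger0_norm _ (`|U w| + `|V w|)) ?addr_ge0//.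
  by rewrite maxEle; case: ifP => _; rewrite ?lerDl ?lerDr.
- apply: (@integrableD _ _ _ _ _ measurableT (EFin \o (fun w => `|U w|))
    (EFin \o (fun w => `|V w|))).
    exact: integrable_abse iU.
  exact: integrable_abse iV.
Qed.

Lemma ae_times (T : nat) (p : nat -> Omega -> Prop) :
    (forall t, (1 <= t <= T)%N -> {ae mu, forall w, p t w}) ->
  {ae mu, forall w, forall t, (1 <= t <= T)%N -> p t w}.
Proof.
move=> H; apply: ae_foralln => t; case: (boolP (1 <= t <= T)%N) => [tT|_].
  by apply: filterS (H t tT).
by apply: aeW => w.
Qed.

End almost_everywhere_integrals.

(** * Order properties of the conditional expectation *)

Section conditional_expectation_order.
Context d (Omega : measurableType d) (R : realType) (P : probability Omega R).
Variable G : set_system Omega.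
Hypotheses (sG : sigma_algebra setT G) (mG : G `<=` measurable).
Implicit Types U V X : Omega -> R.

Let Gfun U := measurable_fun [set: g_sigma_algebraType G]
  (U : g_sigma_algebraType G -> R).

(** On the event [V < U], which lies in [G], the positive function [U - V] has
    nonpositive integral, so this event is null. *)
Lemma ae_le_of_integral U V : Gfun U -> Gfun V ->
    P.-integrable setT (EFin \o U) -> P.-integrable setT (EFin \o V) ->
    (forall A, G A ->
       (\int[P]_(w in A) (U w)%:E <= \int[P]_(w in A) (V w)%:E)%E) ->
  {ae P, forall w, U w <= V w}.
Proof.
move=> mU mV iU iV UV.
pose A := [set w | V w < U w].
have GA : G A.
  have := measurable_fun_ltr mV mU measurableT (Y := [set true]) I.
  by rewrite measurable_g_measurableTypeE// setTI.
have mA := mG GA.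
have iUA : P.-integrable A (EFin \o U) by exact: integrableS iU.
have iVA : P.-integrable A (EFin \o V) by exact: integrableS iV.
have mB : measurable_fun A (fun w => (U w)%:E - (V w)%:E)%E.
  exact: measurable_int (integrableB mA iUA iVA).
have pos w : A w -> (0 <= (U w)%:E - (V w)%:E)%E.
  by rewrite /A/= -EFinB lee_fin subr_ge0 => /ltW.
have I0 : (\int[P]_(w in A) `|(U w)%:E - (V w)%:E| = 0)%E.
  rewrite (eq_integral (fun w => (U w)%:E - (V w)%:E)%E); last first.
    by move=> w /set_mem Aw; rewrite gee0_abs// pos.
  apply/eqP; rewrite eq_le integral_ge0// andbT integralB_EFin//.
  rewrite leeBlDr ?add0e ?UV//.
  exact: integrable_fin_num iVA.
have /ae_eq_integral_abs -/(_ mA mB) E := I0.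
apply: filterS E => w /= h; rewrite leNgt; apply/negP => Aw.
by have /eqP := h Aw; rewrite -EFinB eqe subr_eq0 gt_eqF.
Qed.

Lemma le_condexp U X : Gfun U -> P.-integrable setT (EFin \o U) ->
    P.-integrable setT (EFin \o X) -> {ae P, forall w, U w <= X w} ->
  {ae P, forall w, U w <= condexp P G X w}.
Proof.
move=> mU iU iX UX; have [mW iW WX] := condexpP sG mG iX.
apply: ae_le_of_integral => // A GA; rewrite WX//.
exact: ae_le_integral (mG GA) iU iX UX.
Qed.

Lemma condexp_le V X : Gfun V -> P.-integrable setT (EFin \o V) ->
    P.-integrable setT (EFin \o X) -> {ae P, forall w, X w <= V w} ->
  {ae P, forall w, condexp P G X w <= V w}.
Proof.
move=> mV iV iX XV; have [mW iW WX] := condexpP sG mG iX.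
apply: ae_le_of_integral => // A GA; rewrite WX//.
exact: ae_le_integral (mG GA) iX iV XV.
Qed.

Lemma condexp_id X : Gfun X -> P.-integrable setT (EFin \o X) ->
  {ae P, forall w, condexp P G X w = X w}.
Proof.
move=> mX iX.
have XX : {ae P, forall w, X w <= X w} by apply: aeW => w.
apply: filterS2 (le_condexp mX iX iX XX) (condexp_le mX iX iX XX) => w Xl lX.
by apply/eqP; rewrite eq_le Xl lX.
Qed.

End conditional_expectation_order.

(** * Path maxima *)

Section path_maxima.
Context d (Omega : measurableType d) (R : realType) (T : nat).
Hypothesis hT : (1 <= T)%N.
Implicit Types (X : nat -> Omega -> R) (w : Omega) (c : R).

Lemma path_max_ge X t w : (1 <= t <= T)%N ->
  X t w <= path_max T X w.
Proof.
by move=> tT; apply: le_bigmax_seq => //; rewrite mem_index_iota ltnS.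
Qed.

Lemma path_max_le X w c :
  (forall t, (1 <= t <= T)%N -> X t w <= c) -> path_max T X w <= c.
Proof.
move=> Xc; rewrite /path_max big_seq_cond; apply: bigmax_le => [|i].
  by rewrite Xc// leqnn.
by rewrite andbT mem_index_iota ltnS => /Xc.
Qed.

Lemma path_max_lt X w c :
  (forall t, (1 <= t <= T)%N -> X t w < c) -> path_max T X w < c.
Proof.
move=> Xc; rewrite /path_max big_seq_cond; apply: bigmax_lt => [|i].
  by rewrite Xc// leqnn.
by rewrite andbT mem_index_iota ltnS => /Xc.
Qed.

End path_maxima.

(** * The natural filtration *)

Section filtration.
Context d (Omega : measurableType d) (R : realType) (P : probability Omega R).
Variables (T D : nat) (Y : nat -> {RV P >-> D.-tuple R}).
Hypothesis hT : (1 <= T)%N.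
Local Notation F := (natural_filtration Y).

Lemma sigma_algebra_filtration t : sigma_algebra setT (F t).
Proof. exact: smallest_sigma_algebra. Qed.

Lemma filtration_bigcup t : F t = <<s
  \bigcup_(i in `I_t) preimage_set_system setT (Y i.+1 : Omega -> D.-tuple R) measurable >>.
Proof.
rewrite /natural_filtration /g_sigma_preimage; congr (<<s _ >>).
by rewrite bigcup_mkord.
Qed.

Lemma filtration_measurable t : F t `<=` measurable.
Proof.
rewrite filtration_bigcup; apply: smallest_sub.
  exact: sigma_algebra_measurable.
by apply: bigcup_sub => i _ _ [B mB <-]; exact: measurable_funPT.
Qed.

Lemma filtration_mono s t : (s <= t)%N -> F s `<=` F t.
Proof.
move=> st; rewrite !filtration_bigcup; apply: sub_smallest2r.
  exact: smallest_sigma_algebra.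
by apply: bigcup_subset => i /= is_; exact: leq_trans st.
Qed.

(** Measurability with respect to [F t] is measurability on [Omega] equipped
    with [F t] as its sigma-algebra, which gives access to the general closure
    properties of measurable functions. *)
Definition adapted_fun t (X : Omega -> R) := measurable_fun
  [set: g_sigma_algebraType (F t)] (X : g_sigma_algebraType (F t) -> R).

Lemma adapted_funS s t X : (s <= t)%N -> adapted_fun s X -> adapted_fun t X.
Proof.
move=> st mX _ B mB; have := mX measurableT B mB.
rewrite !measurable_g_measurableTypeE; first exact: filtration_mono.
- exact: sigma_algebra_filtration.
- exact: sigma_algebra_filtration.
Qed.

Lemma condexp_filtration t (X : Omega -> R) : P.-integrable setT (EFin \o X) ->
  condexp_version P (F t) X (condexp P (F t) X).
Proof.
apply: condexpP; first exact: sigma_algebra_filtration.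
exact: filtration_measurable.
Qed.

Definition integrable_process (X : nat -> Omega -> R) := forall t,
  (1 <= t <= T)%N -> adapted_fun t (X t) /\ P.-integrable setT (EFin \o X t).

Lemma path_max_adapted (X : nat -> Omega -> R) : integrable_process X ->
  adapted_fun T (path_max T X) /\ P.-integrable setT (EFin \o path_max T X).
Proof.
move=> pX.
suff H s : {subset s <= index_iota 1 T.+1} ->
    let M w := \big[Num.max/X 1%N w]_(i <- s) X i w in
    adapted_fun T M /\ P.-integrable setT (EFin \o M).
  exact: H.
elim: s => [_|i s IH sT] /=.
  under [fun w => _]funext do rewrite big_nil.
  have [X1 iX1] : _ /\ _ := pX 1%N hT.
  by split => //; exact: adapted_funS X1.
have [|mM iM] := IH; first by move=> j js; apply: sT; rewrite inE js orbT.
under [fun w => _]funext do rewrite big_cons.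
have /pX [mXi iXi] : (1 <= i <= T)%N.
  by have := sT i (mem_head _ _); rewrite mem_index_iota ltnS.
split; last exact: integrable_maxr.
apply: measurable_maxr => //; apply: adapted_funS mXi.
by have := sT i (mem_head _ _); rewrite mem_index_iota ltnS => /andP[].
Qed.

End filtration.

(** * Stopped processes *)

Section stopped_processes.
Context d (Omega : measurableType d) (R : realType) (P : probability Omega R).
Variables (T D : nat) (Y : nat -> {RV P >-> D.-tuple R}).
Hypothesis hT : (1 <= T)%N.
Local Notation F := (natural_filtration Y).

Lemma stopping_time_eq tau t : stopping_time T Y tau -> (1 <= t <= T)%N ->
  F t [set w | tau w = t].
Proof.
move=> [tauT mtau] tT.
have -> : [set w | tau w = t] =
    [set w | (tau w <= t)%N] `\` [set w | (tau w <= t.-1)%N].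
  apply/seteqP; split => w /=.
    move=> ->; split => //; apply/negP; rewrite -ltnNge prednK//.
    by case/andP : tT.
  move=> [le_t /negP]; rewrite -ltnNge => lt_t.
  by apply/eqP; rewrite eqn_leq le_t/=; case: (t) tT lt_t.
rewrite -(@measurable_g_measurableTypeE _ (F t)); last exact: sigma_algebra_filtration.
apply: measurableD; rewrite measurable_g_measurableTypeE;
  try exact: sigma_algebra_filtration.
  exact: mtau.
have [t1|t1] := leqP t 1.
  rewrite (_ : [set _ | _] = set0).
    by case: (sigma_algebra_filtration Y t).
  apply/seteqP; split => w //=.
  have /andP[tau1 _] := tauT w.
  by move=> h; have := leq_trans tau1 h; case: (t) t1 => [|[]].
apply: (filtration_mono (leq_pred t)).
apply: mtau; case/andP : tT => _ tT; apply/andP; split.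
  by rewrite -ltnS prednK// ltnW.
exact: leq_trans (leq_pred t) tT.
Qed.

(** Decomposing along the events [tau = t] reduces everything about a stopped
    process to finite sums. The times are shifted by one so that the index
    ranges over ordinals and the summands are integrable without guards. *)
Lemma stopped_sum tau (X : nat -> Omega -> R) : stopping_time T Y tau ->
  EFin \o (fun w => X (tau w) w) =
  (fun w => \sum_(i < T) ((EFin \o X i.+1) \_ [set w | tau w = i.+1]) w)%E.
Proof.
move=> [tauT _]; apply/funext => w /=.
have /andP[t1 tT] := tauT w.
have tT' : ((tau w).-1 < T)%N by rewrite prednK.
rewrite (bigD1 (Ordinal tT'))//= patchE mem_set/= ?prednK// big1 ?addr0//.
  move=> i neq; rewrite patchE memNset//= => taui.
  by move/eqP : neq; apply; apply/val_inj => /=; rewrite taui.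
Qed.

Lemma measurable_stopping_time_eq tau t : stopping_time T Y tau ->
  (1 <= t <= T)%N -> measurable [set w | tau w = t].
Proof. by move=> st tT; exact: filtration_measurable (stopping_time_eq st tT). Qed.

Let index_time (i : 'I_T) : (1 <= i.+1 <= T)%N. Proof. exact: ltn_ord. Qed.

Lemma integrable_stopped tau X : stopping_time T Y tau ->
    (forall t, (1 <= t <= T)%N -> P.-integrable setT (EFin \o X t)) ->
  P.-integrable setT (EFin \o (fun w => X (tau w) w)).
Proof.
move=> st iX; rewrite (stopped_sum _ st); apply: integrable_sum => // i _.
have mi := measurable_stopping_time_eq st (index_time i).
apply/(integrable_mkcond _ mi).
exact: integrableS measurableT mi (@subsetT _ _) (iX _ (index_time i)).
Qed.

Lemma expectation_stopped tau X : stopping_time T Y tau ->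
    (forall t, (1 <= t <= T)%N -> P.-integrable setT (EFin \o X t)) ->
  ('E_P[fun w => X (tau w) w] =
   \sum_(i < T) \int[P]_(w in [set w | tau w = i.+1]) (X i.+1 w)%:E)%E.
Proof.
move=> st iX; rewrite unlock.
rewrite -[LHS]/(\int[P]_w (EFin \o (fun w => X (tau w) w)) w)%E.
rewrite (stopped_sum _ st) integral_sum//.
  by apply: eq_bigr => i _; rewrite -integral_mkcond.
move=> i; have mi := measurable_stopping_time_eq st (index_time i).
apply/(integrable_mkcond _ mi).
exact: integrableS measurableT mi (@subsetT _ _) (iX _ (index_time i)).
Qed.

(** Optional stopping for the closed martingale [t |-> E[M | F_t]]: since
    [tau = t] is an event of [F t], replacing [E[M | F_t]] by [M] does not
    change the integral over it. *)
Lemma expectation_condexp_stopped tau (M : Omega -> R) : stopping_time T Y tau ->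
    P.-integrable setT (EFin \o M) ->
  ('E_P[fun w => condexp P (F (tau w)) M w] = 'E_P[M])%E.
Proof.
move=> st iM.
rewrite (@expectation_stopped tau (fun t => condexp P (F t) M))//; last first.
  by move=> t _; case: (condexp_filtration Y t iM).
rewrite (@expectation_stopped tau (fun=> M))//.
apply: eq_bigr => i _; have [_ _ ->//] := condexp_filtration Y i.+1 iM.
exact: stopping_time_eq (index_time i).
Qed.

(** The search covers the times [1, .., T - 1] only, and [find] returns the
    length of the list when it fails, so that the value is [T] when the level
    is not reached earlier. *)
Definition hitting_time (X : nat -> Omega -> R) (c : R) (w : Omega) : nat :=
  (find (fun i => c <= X i.+1 w) (iota 0 T.-1)).+1.

Lemma hitting_time_stopping (X : nat -> Omega -> R) c :
    integrable_process T Y X ->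
  stopping_time T Y (hitting_time X c).
Proof.
move=> pX; have bnd w : (1 <= hitting_time X c w <= T)%N.
  rewrite /hitting_time /= -[leqRHS](prednK hT) ltnS.
  by rewrite -[leqRHS](size_iota 0) find_size.
split => // t /andP[t1]; rewrite leq_eqVlt => /predU1P[->|tT].
  rewrite (_ : [set _ | _] = ~` set0).
    by case: (sigma_algebra_filtration Y T) => F0 FC _; rewrite -setTD; exact: FC.
  by apply/seteqP; split => w _ //=; case/andP: (bnd w).
(* At [T] every path counts as stopped, whether or not the level is reached;
   only before [T] is the event read off the values of [X]. *)
rewrite (_ : [set _ | _] = \bigcup_(i in `I_t) [set w | c <= X i.+1 w]).
  rewrite -(@measurable_g_measurableTypeE _ (F t)); last exact: sigma_algebra_filtration.
  apply: bigcup_measurable => i it.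
  have iT : (1 <= i.+1 <= T)%N by exact: leq_trans it (ltnW tT).
  have [mX _] := pX _ iT.
  have := adapted_funS it mX measurableT (measurable_itv `[c, +oo[).
  by rewrite setTI set_itvE.
have tT' : (t <= T.-1)%N by rewrite -ltnS prednK.
apply/seteqP; split => w; rewrite /= /hitting_time.
  rewrite -has_take_leq ?size_iota// take_iota (minn_idPl tT') => /hasP[i].
  by rewrite mem_iota add0n /= => it Xi; exists i.
move=> [i /= it Xi]; rewrite -has_take_leq ?size_iota// take_iota (minn_idPl tT').
by apply/hasP; exists i => //; rewrite mem_iota add0n.
Qed.

(** If the level is not reached before [T], the maximum is attained at [T]. *)
Lemma hitting_time_ge (X : nat -> Omega -> R) c w : c <= path_max T X w ->
  c <= X (hitting_time X c w) w.
Proof.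
move=> cX; rewrite /hitting_time; set p := fun i => c <= X i.+1 w.
have [hp|/hasPn hp] := boolP (has p (iota 0 T.-1)).
  have := nth_find 0%N hp; rewrite nth_iota//.
  by move: hp; rewrite has_find size_iota.
have -> : find p (iota 0 T.-1) = T.-1.
  by rewrite hasNfind ?size_iota//; exact/hasPn.
rewrite prednK// leNgt; apply/negP => XTc; move: cX; rewrite leNgt => /negP; apply.
apply: (path_max_lt hT) => -[//|t] /=; rewrite leq_eqVlt => /predU1P[->//|tT].
by rewrite ltNge; apply: hp; rewrite mem_iota add0n /= -ltnS prednK.
Qed.

End stopped_processes.

(** * The recursion *)

(** The pathwise estimate at the horizon, where [z] and [M] stand for
    [Z j T w] and [M j w]: as [M] increases from index 1 on, each of the [k]
    subtractions after the first one adds at least [- M k] to [z]. *)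
Lemma recursion_lower_bound (R : realType) (z M : nat -> R) k :
    (forall j, z j.+1 = z j - M j) -> (forall j, z j.+1 <= 0) ->
    0 <= z 0%N -> M 0%N <= 1 -> (forall j, M j.+1 <= M j.+2) ->
  (0 < k)%N -> - k%:R^-1 <= M k.
Proof.
move=> zE z0 zge0 M0 Mmono k0.
have Mle j : (0 < j <= k)%N -> M j <= M k.
  case: j k k0 => [//|j] [//|k] _ /=; rewrite ltnS => jk.
  apply: (@homo_leq _ (fun j => M j.+1) (fun x y => x <= y)) jk => //.
  by move=> a b c; exact: le_trans.
have zlb j : (j <= k)%N -> - 1 - j%:R * M k <= z j.+1.
  elim: j => [_|j IH jk]; first by rewrite zE mul0r subr0; lra.
  have := IH (ltnW jk); have : M j.+1 <= M k by exact: Mle.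
  by rewrite (zE j.+1) -natr1 mulrDl mul1r; lra.
have := le_trans (zlb k (leqnn k)) (z0 k).
rewrite subr_le0 => h; have k0R : 0 < k%:R :> R by rewrite ltr0n.
by rewrite -(ler_pM2l k0R) mulrN divff ?gt_eqF.
Qed.

Section recursion.
Context d (Omega : measurableType d) (R : realType) (P : probability Omega R).
Variables (T D : nat) (Y : nat -> {RV P >-> D.-tuple R}).
Hypothesis hT : (1 <= T)%N.
Variable g : forall t, t.-tuple (D.-tuple R) -> R.
Hypothesis mg : forall t : nat, (1 <= t <= T)%N -> measurable_fun setT (g (t:=t)).
Hypothesis intZ : forall t : nat, (1 <= t <= T)%N ->
      P.-integrable setT (EFin \o reward Y g t).
Local Notation F := (natural_filtration Y).
Local Notation Z := (Zseq T Y g).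

Lemma reward_adapted t : (1 <= t <= T)%N -> adapted_fun Y t (reward Y g t).
Proof.
move=> tT; apply: (measurableT_comp (mg tT)).
apply/measurable_fun_tnthP => i.
rewrite (_ : _ \o _ = Y i.+1); last first.
  by apply/funext => w; rewrite /= /history tnth_mktuple.
move=> _ B mB; rewrite measurable_g_measurableTypeE; last exact: sigma_algebra_filtration.
rewrite filtration_bigcup; apply: sub_gen_smallest.
by exists i => //=; exists B.
Qed.

Lemma Zseq_process k : integrable_process T Y (Z k).
Proof.
elim: k => [|k IH] t tT /=; first by split; [exact: reward_adapted|exact: intZ].
have [mZ iZ] := IH t tT.
have [_ iM] := path_max_adapted hT IH.
have [mW iW _] := condexp_filtration Y t iM.
by split; [exact: measurable_funB|exact: (integrableB measurableT iZ iW)].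
Qed.

Lemma integrable_path_max k : P.-integrable setT (EFin \o path_max T (Z k)).
Proof. by have [] := path_max_adapted hT (@Zseq_process k). Qed.

Lemma integrable_Zseq k t : (1 <= t <= T)%N -> P.-integrable setT (EFin \o Z k t).
Proof. by case/(@Zseq_process k). Qed.

Lemma expectation_Zseq_stopped tau k : stopping_time T Y tau ->
  ('E_P[fun w => Z k (tau w) w] =
   'E_P[path_max T (Z k)] + 'E_P[fun w => Z k.+1 (tau w) w])%E.
Proof.
move=> st; have iM := integrable_path_max k.
have iW t : (1 <= t <= T)%N ->
    P.-integrable setT (EFin \o condexp P (F t) (path_max T (Z k))).
  by move=> _; case: (condexp_filtration Y t iM).
rewrite -[fun w => Z k.+1 _ _]/((fun w => Z k (tau w) w) \-
  (fun w => condexp P (F (tau w)) (path_max T (Z k)) w)).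
rewrite expectationB; first last.
- by apply/Lfun1_integrable; exact: (integrable_stopped st iW).
- by apply/Lfun1_integrable; exact: (integrable_stopped st (@integrable_Zseq k)).
rewrite (expectation_condexp_stopped st iM) addeC subeK// expectation_fin_num//.
exact/Lfun1_integrable.
Qed.

(** Telescoping [expectation_Zseq_stopped] from [Z 0], the reward itself. *)
Lemma expectation_reward_stopped tau k : stopping_time T Y tau ->
  ('E_P[fun w => reward Y g (tau w) w] =
   Ek T Y g k + 'E_P[fun w => Z k (tau w) w])%E.
Proof.
move=> st; elim: k => [|k ->]; first by rewrite /Ek big_geq// add0e.
have -> : (Ek T Y g k.+1 = Ek T Y g k + Lk T Y g k.+1)%E.
  by rewrite /Ek big_nat_recr.
by rewrite -addeA -expectation_Zseq_stopped.
Qed.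

Lemma Ek_fin_num k : Ek T Y g k \is a fin_num.
Proof.
apply/sum_fin_numP => i _ _; apply: expectation_fin_num.
by apply/Lfun1_integrable; exact: integrable_path_max.
Qed.

(** [Z k t] is [F t]-measurable and dominated by [M k], hence by
    [E[M k | F_t]]. *)
Lemma Zseq_le0 k t : (1 <= t <= T)%N -> {ae P, forall w, Z k.+1 t w <= 0}.
Proof.
move=> tT; have [mZ iZ] := Zseq_process k tT.
have H : {ae P, forall w, Z k t w <= path_max T (Z k) w}.
  by apply: aeW => w; exact: path_max_ge.
have := le_condexp (sigma_algebra_filtration Y t)
  (@filtration_measurable _ _ _ _ _ Y t) mZ iZ (integrable_path_max k) H.
by apply: filterS => w; rewrite /= subr_le0.
Qed.

Lemma path_max_Zseq_le0 k : {ae P, forall w, path_max T (Z k.+1) w <= 0}.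
Proof.
by apply: filterS (ae_times (@Zseq_le0 k)) => w; exact: path_max_le.
Qed.

(** What is subtracted from [Z k.+1 t] is the conditional expectation of
    [M k.+1], a nonpositive variable. *)
Lemma Zseq_le k t : (1 <= t <= T)%N ->
  {ae P, forall w, Z k.+1 t w <= Z k.+2 t w}.
Proof.
move=> tT.
have H := path_max_Zseq_le0 k.
have m0 : adapted_fun Y t (cst 0) by exact: measurable_cst.
have i0 : P.-integrable setT (EFin \o cst (0 : R)) by exact: integrable0.
have := condexp_le (sigma_algebra_filtration Y t)
  (@filtration_measurable _ _ _ _ _ Y t) m0 i0 (integrable_path_max k.+1) H.
by apply: filterS => w h; rewrite [leRHS]/= lerDl oppr_ge0.
Qed.

Lemma path_max_Zseq_le k :
  {ae P, forall w, path_max T (Z k.+1) w <= path_max T (Z k.+2) w}.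
Proof.
apply: filterS (ae_times (@Zseq_le k)) => w H; apply: (path_max_le hT) => // t tT.
exact: le_trans (H t tT) (path_max_ge _ _ tT).
Qed.

(** The maximum is [F T]-measurable, so conditioning on [F T] leaves it
    unchanged. *)
Lemma Zseq_terminal k :
  {ae P, forall w, Z k.+1 T w = Z k T w - path_max T (Z k) w}.
Proof.
have [mM iM] := path_max_adapted hT (@Zseq_process k).
have := condexp_id (sigma_algebra_filtration Y T)
  (@filtration_measurable _ _ _ _ _ Y T) mM iM.
by apply: filterS => w /= ->.
Qed.

Hypothesis Z01 : forall t : nat, (1 <= t <= T)%N ->
      {ae P, forall w, 0 <= reward Y g t w <= 1}.

Lemma path_max_Zseq_ge k : (0 < k)%N ->
  {ae P, forall w, - k%:R^-1 <= path_max T (Z k) w}.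
Proof.
move=> k0; have TT : (1 <= T <= T)%N by rewrite hT leqnn.
apply: filterS3 (ae_foralln Zseq_terminal) (ae_times Z01)
  (ae_foralln (fun k => filterI (Zseq_le0 k TT) (path_max_Zseq_le k))) => w.
move=> zE r01 zM.
apply: (@recursion_lower_bound _ (fun j => Z j T w)
  (fun j => path_max T (Z j) w)) => //.
- by move=> j; case: (zM j).
- by have /andP[] := r01 T TT.
- by apply: (path_max_le hT) => // t /r01 /andP[].
- by move=> j; case: (zM j).
Qed.

End recursion.

Theorem theorem2 (d : measure_display) (Omega : measurableType d)
    (R : realType) (P : probability Omega R) (T D : nat)
    (hT : (1 <= T)%N) (hD : (1 <= D)%N)
    (Y : nat -> {RV P >-> D.-tuple R})
    (g : forall t : nat, t.-tuple (D.-tuple R) -> R)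
    (mg : forall t : nat, (1 <= t <= T)%N -> measurable_fun setT (g t))
    (intZ : forall t : nat, (1 <= t <= T)%N ->
      P.-integrable setT (EFin \o reward Y g t))
    (OPT_gt0 : (0 < OPT T Y g)%E)
    (Z01 : forall t : nat, (1 <= t <= T)%N ->
      {ae P, forall w, 0 <= reward Y g t w <= 1})
    (k : nat) (hk : (1 <= k)%N) :
  (0 <= Ek T Y g k - OPT T Y g)%E /\
  (Ek T Y g k - OPT T Y g <= (k%:R^-1)%:E)%E.
Proof.
have pZ := Zseq_process hT mg intZ.
have iZ := integrable_Zseq hT mg intZ.
have fE := Ek_fin_num hT mg intZ k.
have decomp := expectation_reward_stopped hT mg intZ k.
have le0 tau : stopping_time T Y tau ->
    ('E_P[fun w => Zseq T Y g k (tau w) w] <= 0)%E.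
  move=> st; rewrite -[leRHS](expectation_cst P 0) unlock.
  apply: ae_le_integral => //; first exact: integrable_stopped st (@iZ k).
    by apply: integrable0.
  case: k hk {fE decomp} => // j _.
  apply: filterS (ae_times (Zseq_le0 hT mg intZ j)) => w; apply.
  by case: st => /(_ w).
(* A near-optimal stopping time: [Z k] first reaches [- 1 / k]. *)
pose c : R := - k%:R^-1.
pose tau := hitting_time T (Zseq T Y g k) c.
have st : stopping_time T Y tau by exact: hitting_time_stopping.
have tau_ge : (c%:E <= 'E_P[fun w => Zseq T Y g k (tau w) w])%E.
  rewrite -[leLHS](expectation_cst P c) unlock.
  apply: ae_le_integral => //.
  - exact: finite_measure_integrable_cst.
  - exact: integrable_stopped st (@iZ k).
  apply: filterS (path_max_Zseq_ge hT mg intZ Z01 hk) => w.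
  exact: hitting_time_ge.
split.
  rewrite sube_ge0; last by rewrite fE ?orbT.
  apply: ge_ereal_sup => _ [sigma ss <-].
  by rewrite (decomp sigma ss) geeDl// le0.
have : ('E_P[fun w => reward Y g (tau w) w] <= OPT T Y g)%E.
  by apply: ereal_sup_ubound; exists tau.
rewrite (decomp tau st) => leOPT.
have : (Ek T Y g k + c%:E <= OPT T Y g)%E.
  by apply: le_trans leOPT; rewrite leeD2l.
move: fE; case: (Ek T Y g k) => [e| |]// _; case: (OPT T Y g) => [v| |]//.
- by rewrite -EFinD -EFinB !lee_fin /c; lra.
- by rewrite addeNy leNye.
Qed.
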